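(* Let $r$ be a positive integer and let $P$ be an $r$-element poset of height at most $2$. Then $\Lambda^*(P) \le 4r + \sqrt{(32 \ln 2)r} + 6$.
   Context: For a positive integer $n$, $[n]=\{1,\dots,n\}$ and $\mathcal{B}_n$ denotes the family of all subsets of $[n]$ ordered by inclusion. A poset $P$ is a subposet of $Q$ if $P\subseteq Q$ and $x\le_P y$ iff $x\le_Q y$; a family $\mathcal{F}\subseteq\mathcal{B}_n$ (ordered by inclusion) contains a copy of $P$ if some subposet of $(\mathcal{F},\subseteq)$ is isomorphic to $P$, and $\mathcal{F}$ is $P$-free otherwise. The height of a poset is the maximum size of a chain. The Lubell function of $\mathcal{F}\subseteq\mathcal{B}_n$ is $\ell(\mathcal{F})=\sum_{A\in\mathcal{F}}1/\binom{n}{|A|}$ (the expected number of sets of $\mathcal{F}$ on a uniformly random maximal chain of $\mathcal{B}_n$). The strong Lubell threshold is $\Lambda^*(P)=\sup\{\ell(\mathcal{F}) : n\ge 1,\ \mathcal{F}\subseteq\mathcal{B}_n,\ \mathcal{F}\text{ is }P\text{-free}\}$. *)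

(* Defs.v *)
From HB Require Import structures.
From mathcomp Require Import all_boot all_order all_algebra.
From mathcomp Require Import all_classical all_reals all_analysis.

Set Implicit Arguments.
Unset Strict Implicit.
Unset Printing Implicit Defensive.

Import Order.TTheory GRing.Theory Num.Theory.

Local Open Scope ring_scope.

Definition is_chain (d : Order.disp_t) (P : finPOrderType d)
    (C : {set P}) : bool :=
  [forall x in C, forall y in C, (x <= y)%O || (y <= x)%O].

Definition height (d : Order.disp_t) (P : finPOrderType d) : nat :=
  (\max_(C : {set P} | is_chain C) #|C|)%N.

(* The ground set [n] is 'I_n and B_n is {set 'I_n}.  The subfamily G carries
   the order induced by inclusion, so it is the subposet isomorphic to P. *)
Definition contains_copy (n : nat) (d : Order.disp_t) (P : finPOrderType d)
    (F : {set {set 'I_n}}) : Prop :=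
  exists2 G : {set {set 'I_n}}, G \subset F &
    exists f : P -> {set 'I_n},
      [/\ injective f, f @: [set: P] = G &
          forall x y : P, (x <= y)%O = (f x \subset f y)].

Definition poset_free (n : nat) (d : Order.disp_t) (P : finPOrderType d)
    (F : {set {set 'I_n}}) : Prop :=
  ~ contains_copy P F.

Definition lubell (R : realType) (n : nat) (F : {set {set 'I_n}}) : R :=
  \sum_(A in F) ('C(n, #|A|)%:R)^-1.

(* The supremum is taken in the extended reals because it is not known a
   priori to be finite. *)
Definition strong_lubell (R : realType) (d : Order.disp_t)
    (P : finPOrderType d) : \bar R :=
  ereal_sup
    [set x : \bar R | exists (n : nat) (F : {set {set 'I_n}}),
       [/\ (0 < n)%N, poset_free P F & x = (lubell R F)%:E]]%classic.

(* Main.v *)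
Require Import Defs.
From HB Require Import structures.
From mathcomp Require Import all_boot all_order all_algebra.
From mathcomp Require Import zify lra ring.

(** Say that [e] is covered by [V] when some member [X] of the family satisfies
    [e \in X] and [X \subset e |: V].  It suffices to find a set [V] and an
    [r]-set [E] disjoint from [V], one point [e x] for each [x : P], such that
    every point of [E] is covered by [V] and the members containing [V] shatter
    [E].  Then minimal elements [x] are sent to sets covering [e x], the other
    elements [y] to members [Y] containing [V] with
    [Y :&: E = [set e z | z <= y]], and this is an embedding when the height is
    at most 2.

    Shattering: conditioning a random maximal chain on its first (resp. last)
    point, and replacing the link and the deletion of that point by their union
    and intersection as in the Sauer-Shelah induction, one gets that a family
    shattering no [r]-subset of a set [G] of points has Lubell function at most
    [2 r (N + 1) / (#|G| + 1)] on [N] points.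

    Covering: start from a set whose upper interval has maximal Lubell value [L]
    and add points one at a time.  If [y] is not covered by [V], no set in
    [[y |: V0, y |: V]] is a member, so the deficiency [L - upper_lubell] keeps
    its mean along these sets.  Adding points until about half of the remaining
    ones are covered therefore leads to an upper interval of Lubell value at
    least [L - 2].  With [#|G|] about [N / 2] the family then shatters an
    [r]-set of covered points as soon as its Lubell value exceeds [4 r + 4]. *)

Set Implicit Arguments.
Unset Strict Implicit.
Unset Printing Implicit Defensive.

Import Order.TTheory GRing.Theory Num.Theory.

Local Open Scope ring_scope.

(** * Lubell functions on a finite ground set and their one-point recursions *)

Section LubellOn.
Variables (R : realFieldType) (T : finType).
Implicit Types (V W E G S Y : {set T}) (H : {set {set T}}) (y : T).

Definition lubell_on V H : R :=
  \sum_(Y in H | Y \subset V) ('C(#|V|, #|Y|)%:R)^-1.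

(** Sets [Y] containing [y] are not excluded; evaluation on [V :\ y] leaves only those avoiding
    [y]. *)
Definition link y H : {set {set T}} := [set Y | y |: Y \in H].

Lemma lubell_onE V H :
  lubell_on V H =
    \sum_(Y : {set T} | Y \subset V) (Y \in H)%:R * ('C(#|V|, #|Y|)%:R)^-1.
Proof.
rewrite /lubell_on big_mkcondl; apply: eq_bigr => Y _.
by case: (Y \in H); rewrite ?mul1r ?mul0r.
Qed.

Lemma lubell_on_set0 H : lubell_on set0 H = (set0 \in H)%:R.
Proof.
rewrite lubell_onE; under eq_bigl => Y do rewrite subset0.
by rewrite big_pred1_eq cards0 bin0 invr1 mulr1.
Qed.

Lemma lubell_onUI V H1 H2 :
  lubell_on V (H1 :|: H2) + lubell_on V (H1 :&: H2) =
  lubell_on V H1 + lubell_on V H2.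
Proof.
rewrite !lubell_onE -!big_split; apply: eq_bigr => Y _ /=.
rewrite -!mulrDl; congr (_ * _); rewrite !inE.
by case: (Y \in H1); case: (Y \in H2); rewrite ?addr0 ?add0r.
Qed.

Lemma inv_bin_del (N k : nat) : (k <= N)%N ->
  N%:R * ('C(N, k)%:R)^-1 =
  N%:R * (k == N)%:R + (N - k)%:R * ('C(N.-1, k)%:R)^-1 :> R.
Proof.
move=> kN; case: eqVneq => [->|neq].
  by rewrite binn subnn mul0r addr0 invr1.
have lt_kN : (k < N)%N by rewrite ltn_neqAle neq.
rewrite mulr0 add0r; apply/eqP.
rewrite -[_ == _]/(_ / _ == _ / _) eqr_div ?pnatr_eq0 -?lt0n ?bin_gt0 //; last lia.
by rewrite -!natrM mul_bin_down.
Qed.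

Lemma inv_bin_link (N k : nat) : (k <= N)%N ->
  N%:R * ('C(N, k)%:R)^-1 =
  N%:R * (k == 0)%:R + k%:R * ('C(N.-1, k.-1)%:R)^-1 :> R.
Proof.
case: k => [_|k kN]; first by rewrite bin0 invr1 mul0r addr0.
rewrite mulr0 add0r; apply/eqP.
rewrite -[_ == _]/(_ / _ == _ / _) eqr_div ?pnatr_eq0 -?lt0n ?bin_gt0 //; last lia.
by rewrite -!natrM mul_bin_diag.
Qed.

(** A random maximal chain below [V] consists of [V] and a random maximal chain below [V :\ y], with
    its last point [y] uniform in [V]. *)
Lemma lubell_on_del V H :
  #|V|%:R * lubell_on V H =
  #|V|%:R * (V \in H)%:R + \sum_(y in V) lubell_on (V :\ y) H.
Proof.
under eq_bigr => y yV do rewrite lubell_onE.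
rewrite (exchange_big_dep (fun Y => Y \subset V)) /=; last first.
  by move=> y Y _; rewrite subsetD1 => /andP[].
rewrite lubell_onE big_distrr /=.
have -> : #|V|%:R * (V \in H)%:R =
    \sum_(Y : {set T} | Y \subset V) (Y \in H)%:R * (#|V|%:R * (#|Y| == #|V|)%:R) :> R.
  rewrite (bigD1 V) //= eqxx mulr1 mulrC big1 ?addr0 // => Y /andP[YV neq].
  by rewrite (ltn_eqF (proper_card _)) ?mulr0 // properEneq neq.
rewrite -big_split; apply: eq_bigr => Y YV /=.
rewrite mulrCA inv_bin_del ?subset_leq_card // mulrDr; congr (_ + _).
transitivity (\sum_(y in V :\: Y) (Y \in H)%:R * ('C(#|V|.-1, #|Y|)%:R)^-1 : R).
  rewrite sumr_const cardsD (setIidPr YV) -[RHS]mulr_natr; ring.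
apply: eq_big => y.
  by rewrite !inE subsetD1 YV andbC.
by rewrite inE => /andP[_ yV]; rewrite (cardsD1 y V) yV.
Qed.

(** The same chain read from the bottom: after [set0] come the sets [y |: Y], with [Y] on a random
    chain of [V :\ y] and [y] the first point. *)
Lemma lubell_on_link V H :
  #|V|%:R * lubell_on V H =
  #|V|%:R * (set0 \in H)%:R + \sum_(y in V) lubell_on (V :\ y) (link y H).
Proof.
have {}shift y : y \in V -> lubell_on (V :\ y) (link y H) =
   \sum_(Y : {set T} | (Y \subset V) && (y \in Y))
      (Y \in H)%:R * ('C(#|V|.-1, #|Y|.-1)%:R)^-1.
  move=> yV; rewrite lubell_onE.
  rewrite [RHS](reindex_onto (fun Y => y |: Y) (fun Y => Y :\ y)) /=; last first.
    by move=> Y /andP[_ yY]; rewrite setD1K.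
  apply: eq_big => Y.
    rewrite subsetD1 subUset sub1set yV setU11 andbT /=; congr (_ && _).
    by apply/idP/eqP => [yY|<-]; [rewrite setU1K | rewrite setD11].
  by rewrite subsetD1 => /andP[_ yY]; rewrite inE cardsU1 yY (cardsD1 y V) yV.
under eq_bigr => y yV do rewrite shift //.
rewrite (exchange_big_dep (fun Y => Y \subset V)) /=; last first.
  by move=> y Y _ /andP[].
rewrite lubell_onE big_distrr /=.
have -> : #|V|%:R * (set0 \in H)%:R =
    \sum_(Y : {set T} | Y \subset V) (Y \in H)%:R * (#|V|%:R * (#|Y| == 0)%:R) :> R.
  rewrite (bigD1 set0) ?sub0set //= cards0 eqxx mulr1 mulrC big1 ?addr0 //.
  by move=> Y /andP[YV neq]; rewrite cards_eq0 (negPf neq) !mulr0.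
rewrite -big_split; apply: eq_bigr => Y YV /=.
rewrite mulrCA inv_bin_link ?subset_leq_card // mulrDr; congr (_ + _).
transitivity (\sum_(y in Y) (Y \in H)%:R * ('C(#|V|.-1, #|Y|.-1)%:R)^-1 : R).
  rewrite sumr_const -[RHS]mulr_natr; ring.
apply: eq_bigl => y; rewrite YV /=.
by apply/idP/andP => [yY|[]//]; rewrite (subsetP YV).
Qed.

(** * Shattering and the Lubell function *)

Definition shatters V H E : bool :=
  [forall S : {set T}, (S \subset E) ==>
     [exists Y : {set T}, [&& Y \in H, Y \subset V & Y :&: E == S]]].

Lemma shattersP V H E :
  reflect (forall S, S \subset E -> exists Y, [/\ Y \in H, Y \subset V & Y :&: E = S])
          (shatters V H E).
Proof.
apply: (iffP forallP) => [sh S SE | sh S].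
  by have /implyP/(_ SE)/existsP[Y /and3P[? ? /eqP]] := sh S; exists Y.
apply/implyP => /sh[Y [YH YV <-]].
by apply/existsP; exists Y; rewrite YH YV eqxx.
Qed.

Lemma setIU1_notin y Y E : y \notin E -> (y |: Y) :&: E = Y :&: E.
Proof.
move=> yE; apply/setP => x; rewrite !inE.
by case: eqP => [->|//]; rewrite (negPf yE) !andbF.
Qed.

Lemma shatters_linkU y V H E : y \in V -> y \notin E ->
  shatters (V :\ y) (link y H :|: H) E -> shatters V H E.
Proof.
move=> yV yE /shattersP sh; apply/shattersP => S /sh[Y []].
rewrite !inE subsetD1 => /orP[YH|YH] /andP[YV _] YE; last by exists Y.
by exists (y |: Y); rewrite YH subUset sub1set yV YV setIU1_notin.
Qed.

(** A set [Y] avoiding [y] and lying in both families gives the two members [Y] and [y |: Y] of [H],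
    so the trace on [y] can be prescribed freely. *)
Lemma shatters_linkI y V H E : y \in V -> y \notin E ->
  shatters (V :\ y) (link y H :&: H) E -> shatters V H (y |: E).
Proof.
move=> yV yE /shattersP sh; apply/shattersP => S SyE.
have SE : S :\ y \subset E by rewrite subDset.
have [Y []] := sh _ SE; rewrite !inE subsetD1 => /andP[yYH YH] /andP[YV yY] YE.
case: (boolP (y \in S)) => yS; [exists (y |: Y) | exists Y].
  by rewrite yYH subUset sub1set yV YV -setUIr YE setD1K.
rewrite YH YV; split=> //.
rewrite setIC setIU1_notin // setIC YE.
by apply/setDidPl; rewrite disjoint_sym disjoints1.
Qed.

Lemma shattersS V H1 H2 E : H1 \subset H2 -> shatters V H1 E -> shatters V H2 E.
Proof.
move=> /subsetP s12 /shattersP sh; apply/shattersP => S /sh[Y [YH YV YE]].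
by exists Y; rewrite s12.
Qed.

Lemma lubell_on0 V H : ~~ shatters V H set0 -> lubell_on V H = 0.
Proof.
move=> /shattersP nsh; rewrite /lubell_on big1 // => Y /andP[YH YV]; case: nsh.
by move=> S; rewrite subset0 => /eqP ->; exists Y; rewrite setI0.
Qed.

(* The factor (#|V| + 1) / (#|G| + 1) is the solution of the recursion in
   which a uniformly random point of V is deleted. *)
Lemma lubell_on_not_shatters V G H (r : nat) : G \subset V ->
  (forall E, E \subset G -> #|E| = r -> ~~ shatters V H E) ->
  #|G|.+1%:R * lubell_on V H <= (2 * r)%:R * #|V|.+1%:R.
Proof.
move: {2}#|V| (erefl #|V|) => N.
elim: N V G H r => [|N IH] V G H [|r] cV GV nsh.
- by rewrite lubell_on0 ?mulr0 ?mulr_ge0 ?ler0n //; apply: nsh; rewrite ?sub0set ?cards0.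
- have V0 : V = set0 by apply/eqP; rewrite -cards_eq0 cV.
  rewrite V0 subset0 in GV; rewrite (eqP GV) V0 cards0 lubell_on_set0.
  rewrite mul1r mulr1 ler_nat; case: (_ \in _); lia.
- by rewrite lubell_on0 ?mulr0 ?mulr_ge0 ?ler0n //; apply: nsh; rewrite ?sub0set ?cards0.
pose B := lubell_on V H.
have cV1 y : y \in V -> #|V :\ y| = N.
  by move=> yV; move: cV; rewrite (cardsD1 y V) yV; case.
(* Both [G] and [V] lose [y]: the union shatters no [r.+1]-subset of [G :\ y] and the intersection
   no [r]-subset, whence [2 * r.+1 + 2 * r]. *)
have step_good y : y \in G ->
    #|G|%:R * (lubell_on (V :\ y) (link y H) + lubell_on (V :\ y) H)
      <= (4 * r + 2)%:R * N.+1%:R.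
  move=> yG; have yV := subsetP GV _ yG.
  have cG : #|G :\ y|.+1 = #|G| by rewrite (cardsD1 y G) yG.
  have GVy : G :\ y \subset V :\ y by apply: setSD.
  rewrite -lubell_onUI mulrDr.
  have h1 : #|G|%:R * lubell_on (V :\ y) (link y H :|: H)
              <= (2 * r.+1)%:R * N.+1%:R.
    rewrite -cG -(cV1 _ yV); apply: IH => //; first exact: cV1.
    move=> E EG cE; apply: contra (nsh E _ cE); last first.
      exact: subset_trans EG (subD1set _ _).
    apply: shatters_linkU => //; apply/negP => /(subsetP EG).
    by rewrite !inE eqxx.
  have h2 : #|G|%:R * lubell_on (V :\ y) (link y H :&: H)
              <= (2 * r)%:R * N.+1%:R.
    rewrite -cG -(cV1 _ yV); apply: IH => //; first exact: cV1.
    move=> E EG cE.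
    have yE : y \notin E by apply/negP => /(subsetP EG); rewrite !inE eqxx.
    apply: contra (nsh (y |: E) _ _).
    - exact: shatters_linkI.
    - by rewrite subUset sub1set yG (subset_trans EG (subD1set _ _)).
    - by rewrite cardsU1 yE cE.
  apply: le_trans (lerD h1 h2) _; rewrite -mulrDl -natrD -!natrM ler_nat; nia.
(* Here [G] survives, and neither the link nor the deletion shatters an [r.+1]-subset of it, whence
   twice [2 * r.+1]. *)
have step_bad y : y \in V :\: G ->
    #|G|.+1%:R * (lubell_on (V :\ y) (link y H) + lubell_on (V :\ y) H)
      <= (4 * r.+1)%:R * N.+1%:R.
  rewrite inE => /andP[yG yV].
  have GVy : G \subset V :\ y by rewrite subsetD1 GV.
  have h H' : H' \subset link y H :|: H ->
      #|G|.+1%:R * lubell_on (V :\ y) H' <= (2 * r.+1)%:R * N.+1%:R.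
    move=> sH; rewrite -(cV1 _ yV); apply: IH => //; first exact: cV1.
    move=> E EG cE; apply: contra (nsh E EG cE) => /(shattersS sH).
    by apply: shatters_linkU => //; apply: contra yG; apply: (subsetP EG).
  rewrite mulrDr; apply: le_trans (lerD (h _ (subsetUl _ _)) (h _ (subsetUr _ _))) _.
  rewrite -mulrDl -natrD -!natrM ler_nat; nia.
(* The two recursions are added; the chain ends [set0] and [V] cost at most 1 each in the mean. *)
have two : N.+1%:R * (B + B) <= (2 * N.+1)%:R +
    \sum_(y in V) (lubell_on (V :\ y) (link y H) + lubell_on (V :\ y) H).
  rewrite big_split /= mulrDr -cV {1}lubell_on_link lubell_on_del natrM.
  have b0 : (set0 \in H)%:R <= 1 :> R by case: (_ \in _).
  have b1 : (V \in H)%:R <= 1 :> R by case: (_ \in _).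
  have := ler_wpM2l (ler0n R #|V|) b0; have := ler_wpM2l (ler0n R #|V|) b1.
  lra.
rewrite (big_setID G) /= (setIidPr GV) in two.
have sumG : \sum_(y in G) (lubell_on (V :\ y) (link y H) + lubell_on (V :\ y) H)
    <= (if G == set0 then 0 else (4 * r + 2)%:R * N.+1%:R).
  case: eqVneq => [->|G0]; first by rewrite big_set0.
  have cG : 0 < #|G|%:R :> R by rewrite ltr0n card_gt0.
  rewrite -(ler_pM2l cG) big_distrr /= [leRHS]mulr_natl -[leRHS]sumr_const.
  exact: ler_sum.
have sumB : #|G|.+1%:R *
   \sum_(y in V :\: G) (lubell_on (V :\ y) (link y H) + lubell_on (V :\ y) H)
    <= (N.+1 - #|G|)%:R * ((4 * r.+1)%:R * N.+1%:R).
  have -> : (N.+1 - #|G| = #|V :\: G|)%N by rewrite cardsD (setIidPr GV) cV.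
  by rewrite big_distrr /= [leRHS]mulr_natl -[leRHS]sumr_const; apply: ler_sum.
have gN : (#|G| <= N.+1)%N by rewrite -cV subset_leq_card.
have n0 : 0 < N.+1%:R * 2 :> R by rewrite mulr_gt0 ?ltr0n.
rewrite -/B cV -(ler_pM2l n0).
move: sumG sumB two.
set SG := \sum_(y in G) _; set SB := \sum_(y in _) _.
rewrite natrB // !natrM natrD natrM -[N.+2%:R]natr1 -[N.+1%:R]natr1.
rewrite -[r.+1%:R]natr1 -[#|G|.+1%:R]natr1.
set g := #|G|%:R; set nN := N%:R; set s := r%:R => sumG sumB two.
have g0 : 0 <= g by apply: ler0n.
have nN0 : 0 <= nN by apply: ler0n.
have s0 : 0 <= s by apply: ler0n.
have hSG : SG <= (4 * s + 2) * (nN + 1).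
  by apply: le_trans sumG _; case: ifP => // _; rewrite mulr_ge0 //; lra.
have g10 : 0 <= g + 1 by rewrite addr_ge0.
(* The 2 from the chain ends raises [4 * s + 2] to [4 * (s + 1)], and then
   [(g + 1) + (nN + 1 - g) = nN + 2] closes the recursion exactly. *)
have := ler_wpM2l g10 hSG; have := ler_wpM2l g10 two.
lra.
Qed.

(** * Upper intervals and covered points *)

(** Expected number of members of [H] on a random maximal chain from [V] to [setT]. *)
Definition upper_lubell H V : R :=
  lubell_on (~: V) [set Y | V :|: Y \in H].

Lemma upper_lubell_rec H V :
  #|~: V|%:R * upper_lubell H V =
  #|~: V|%:R * (V \in H)%:R + \sum_(y in ~: V) upper_lubell H (y |: V).
Proof.
rewrite /upper_lubell lubell_on_link inE setU0; congr (_ + _).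
apply: eq_bigr => y yV; congr (lubell_on _ _).
  by rewrite setCU setIC -setDE.
by apply/setP => Y; rewrite !inE setUCA setUA.
Qed.

(** A maximal chain has [#|V|.+1] sets. This later forces [~: V] to be large. *)
Lemma lubell_on_le V H : lubell_on V H <= #|V|.+1%:R.
Proof.
move: {2}#|V| (erefl #|V|) => N.
elim: N V H => [|N IH] V H cV.
  have -> : V = set0 by apply/eqP; rewrite -cards_eq0 cV.
  by rewrite lubell_on_set0 cards0; case: (_ \in _).
have n0 : 0 < #|V|%:R :> R by rewrite cV ltr0n.
rewrite -(ler_pM2l n0) lubell_on_link -natr1 mulrDr mulr1 addrC.
apply: lerD; last by case: (_ \in _); rewrite ?mulr1 ?mulr0 // ltW.
rewrite mulr_natl -sumr_const; apply: ler_sum => y yV.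
have cVy : #|V :\ y| = N by move: cV; rewrite (cardsD1 y V) yV => -[].
by rewrite cV -cVy IH.
Qed.

Lemma exists_le_mean (C : {set T}) (f : T -> R) (c : R) : C != set0 ->
  \sum_(z in C) f z <= #|C|%:R * c -> exists2 z, z \in C & f z <= c.
Proof.
move=> C0 le_sum; apply/exists_inP; apply: contraTT le_sum.
rewrite negb_exists_in -ltNge => /forall_inP lt_f.
rewrite mulr_natl -sumr_const; apply: ltr_sum => [|z zC].
  by have /set0Pn[z zC] := C0; apply/hasP; exists z; rewrite ?mem_index_enum.
by rewrite ltNge lt_f.
Qed.

Definition uncovered H V : {set T} :=
  [set y | (y \notin V) && ~~ [exists X in H, (y \in X) && (X \subset y |: V)]].

Lemma uncovered_subC H V : uncovered H V \subset ~: V.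
Proof. by apply/subsetP => y; rewrite !inE => /andP[]. Qed.

Lemma uncovered_notin H V y : y \in uncovered H V -> y |: V \notin H.
Proof.
rewrite inE => /andP[_]; apply: contra => yVH; apply/exists_inP.
by exists (y |: V); rewrite // setU11 subxx.
Qed.

Lemma uncoveredU1 H V z : uncovered H (z |: V) \subset uncovered H V :\ z.
Proof.
apply/subsetP => y; rewrite !inE negb_or => /andP[/andP[-> ->]] /=.
apply: contra => /exists_inP[X XH /andP[yX XV]]; apply/exists_inP.
by exists X; rewrite // yX (subset_trans XV) // setUS // subsetUr.
Qed.

(** * Averaging the deficiency while points are added *)

Section Deficiency.
Variables (H : {set {set T}}) (L : R).
Hypothesis upper_le : forall V, upper_lubell H V <= L.

Definition deficiency V : R := L - upper_lubell H V.

Lemma deficiency_ge0 V : 0 <= deficiency V.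
Proof. by rewrite subr_ge0. Qed.

Lemma sum_deficiency V :
  \sum_(y in ~: V) deficiency (y |: V) =
  #|~: V|%:R * (deficiency V + (V \in H)%:R).
Proof.
rewrite /deficiency sumrB sumr_const.
have := upper_lubell_rec H V; rewrite -[L *+ _]mulr_natl; lra.
Qed.

Lemma cardsCU1 V y : y \notin V -> #|~: V| = #|~: (y |: V)|.+1.
Proof. by move=> yV; rewrite (cardsD1 y) inE yV setCU setIC -setDE. Qed.

(** Average over [z]. For uncovered [y] the set [y |: V] is not a member, so the mean of
    [deficiency (y |: (z |: V))] over the other points [z] outside [V] is [deficiency (y |: V)]. The
    total over all [z] is thus at most [#|~: V|.-1 * #|~: V|]. *)
Lemma uncovered_extend V : uncovered H V != set0 ->
  \sum_(y in uncovered H V) deficiency (y |: V) <= #|~: V|%:R ->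
  exists2 z, z \notin V &
    \sum_(y in uncovered H V :\ z) deficiency (y |: (z |: V))
      <= #|~: (z |: V)|%:R.
Proof.
move=> /set0Pn[y0 y0U] leS.
have C0 : ~: V != set0.
  by apply/set0Pn; exists y0; apply: (subsetP (uncovered_subC H V)).
have [|z] := @exists_le_mean (~: V)
   (fun z => \sum_(y in uncovered H V :\ z) deficiency (y |: (z |: V)))
   #|~: V|.-1%:R C0.
  rewrite (exchange_big_dep (fun y => y \in uncovered H V)) /=; last first.
    by move=> z y _; rewrite in_setD1 => /andP[].
  have inner y : y \in uncovered H V ->
      \sum_(z in ~: V | y \in uncovered H V :\ z) deficiency (y |: (z |: V)) =
      #|~: V|.-1%:R * deficiency (y |: V).
    move=> yU; have yV : y \notin V.
      by have := subsetP (uncovered_subC H V) _ yU; rewrite inE.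
    rewrite (cardsCU1 yV) /= -[deficiency (y |: V)]addr0.
    (* The zero just added becomes the membership indicator of [y |: V], as [sum_deficiency]
       requires. *)
    rewrite -[X in _ + X]/(false%:R) -(negPf (uncovered_notin yU)).
    rewrite -sum_deficiency; apply: eq_big => z.
      by rewrite in_setD1 yU andbT !inE negb_or andbC eq_sym.
    by rewrite setUCA.
  rewrite (eq_bigr _ inner) -big_distrr /= mulrC.
  by apply: ler_wpM2r.
by rewrite inE => zV le_z; exists z => //; move: le_z; rewrite (cardsCU1 zV).
Qed.

(** Points are added by [uncovered_extend] until the uncovered ones drop to about half of the rest;
    this gives [W]. One more point, chosen for its small deficiency, gives [V']. *)
Lemma uncovered_descent V :
  (#|~: V|.+2 <= 2 * #|uncovered H V|)%N ->
  \sum_(y in uncovered H V) deficiency (y |: V) <= #|~: V|%:R ->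
  exists W V', [/\ W \subset V', deficiency V' <= 2 &
    (2 * #|uncovered H W :\: V'| <= #|~: V'|.+2)%N].
Proof.
move: {2}#|~: V| (erefl #|~: V|) => N.
elim: N V => [|N IH] V cV leN leS.
  have := subset_leq_card (uncovered_subC H V); lia.
have U0 : uncovered H V != set0 by rewrite -card_gt0; lia.
have [z zV leS'] := uncovered_extend U0 leS.
have cz := cardsCU1 zV.
have cU : (#|uncovered H V| <= #|uncovered H V :\ z|.+1)%N.
  by rewrite (cardsD1 z (uncovered H V)); case: (z \in _).
have [le2|gt2] := leqP #|~: (z |: V)|.+2 (2 * #|uncovered H (z |: V)|).
  apply: (IH (z |: V)) => //; first lia.
  apply: le_trans leS'.
  rewrite [leRHS](big_setID (uncovered H (z |: V))) /=.
  rewrite (setIidPr (uncoveredU1 _ _ _)) lerDl.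
  by apply: sumr_ge0 => y _; apply: deficiency_ge0.
(* The process stops at [z |: V]. As [V] had not reached the threshold, [uncovered H V :\ z] has
   more than half as many points as [~: (z |: V)], so [leS'] yields one of deficiency at most 2. *)
have U1 : uncovered H V :\ z != set0 by rewrite -card_gt0; lia.
have [|y yU dy] := @exists_le_mean _ (fun y => deficiency (y |: (z |: V))) 2 U1.
  apply: le_trans leS' _; rewrite -natrM ler_nat; lia.
have yzV : y \notin z |: V.
  move: yU; rewrite !inE => /andP[yz /andP[yV _]].
  by rewrite (negPf yz).
exists (z |: V), (y |: (z |: V)); split => //; first exact: subsetUr.
have := subset_leq_card (subsetDl (uncovered H (z |: V)) (y |: (z |: V))).
have := cardsCU1 yzV; lia.
Qed.

End Deficiency.

(** * A shattered set of covered points *)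

Lemma upper_lubell_covered H : exists W V,
  [/\ W \subset V, lubell_on setT H - 2 <= upper_lubell H V &
    (2 * #|uncovered H W :\: V| <= #|~: V|.+2)%N].
Proof.
pose V0 := [arg max_(V > set0 : {set T}) upper_lubell H V]%O.
pose L := upper_lubell H V0.
have leL V : upper_lubell H V <= L.
  by rewrite /L /V0; case: arg_maxP => // V1 _; apply.
have le0 : lubell_on setT H <= L.
  suff -> : lubell_on setT H = upper_lubell H set0 by [].
  rewrite /upper_lubell setC0; congr (lubell_on _ _).
  by apply/setP => Y; rewrite inE set0U.
have dL0 : deficiency H L V0 = 0 by rewrite /deficiency subrr.
have [ok|nok] := leqP (2 * #|uncovered H V0|) #|~: V0|.+1.
  exists V0, V0; split=> //; first by rewrite -/L; lra.
  have := subset_leq_card (subsetDl (uncovered H V0) V0); lia.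
(* As [V0] has deficiency 0, the sum over its whole complement is [#|~: V0|] times the indicator of
   [V0 \in H]. *)
have [|W [V [WV dV cU]]] := uncovered_descent leL nok.
  apply: (@le_trans _ _ (\sum_(y in ~: V0) deficiency H L (y |: V0))).
    rewrite [leRHS](big_setID (uncovered H V0)) /=.
    rewrite (setIidPr (uncovered_subC H V0)) lerDl.
    by apply: sumr_ge0 => y _; apply: deficiency_ge0.
  by rewrite sum_deficiency dL0 add0r; case: (_ \in _); rewrite ?mulr1 ?mulr0.
exists W, V; split=> //; move: dV; rewrite /deficiency; lra.
Qed.

Lemma covered_shatters H (r : nat) : (0 < r)%N ->
  (4 * r + 4)%:R < lubell_on setT H ->
  exists W V E, [/\ W \subset V, #|E| = r,
    E \subset ~: V :\: uncovered H W &
    forall S, S \subset E -> exists Y, [/\ Y \in H, V \subset Y & Y :&: E = S]].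
Proof.
move=> r0 big; have [W [V [WV leV cU]]] := upper_lubell_covered H.
pose G := ~: V :\: uncovered H W.
have GV : G \subset ~: V by apply: subsetDl.
have cG : (#|G| + #|uncovered H W :\: V| = #|~: V|)%N.
  rewrite -(cardsID (uncovered H W) (~: V)) addnC; congr (_ + _)%N.
  by rewrite setIC setDE.
case: (boolP [exists E : {set T}, [&& E \subset G, #|E| == r &
         shatters (~: V) [set Y | V :|: Y \in H] E]]).
  move=> /existsP[E /and3P[EG /eqP cE /shattersP sh]].
  exists W, V, E; split=> // S /sh[Y [YH YV YE]].
  exists (V :|: Y); rewrite subsetUl; split=> //; first by rewrite inE in YH.
  have EV : [disjoint E & V] by rewrite disjoints_subset (subset_trans EG).
  by rewrite -YE setIUl [V :&: E]setIC (disjoint_setI0 EV) set0U.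
rewrite negb_exists => /forallP nsh.
have nshG E : E \subset G -> #|E| = r ->
    ~~ shatters (~: V) [set Y | V :|: Y \in H] E.
  by move=> EG cE; have := nsh E; rewrite EG cE eqxx.
have le1 := lubell_on_le (~: V) [set Y | V :|: Y \in H].
rewrite -/(upper_lubell H V) in le1.
have cV : (4 * r + 1 < #|~: V|)%N.
  rewrite -(ltr_nat R); move: le1 big; rewrite -natr1 !natrD; lra.
have cG2 : (#|~: V| <= 2 * #|G| + 2)%N by lia.
have le2 := lubell_on_not_shatters GV nshG; rewrite -/(upper_lubell H V) in le2.
(* Of [4 * r + 4], 2 was lost in passing to [V]. With [cG2] the inequality would force
   [#|G|.+1 < r], while [cV] makes [#|G|] at least [2 * r]. *)
have : #|G|.+1%:R * (4 * r + 2)%:R < (2 * r)%:R * #|~: V|.+1%:R :> R.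
  apply: lt_le_trans le2; rewrite ltr_pM2l ?ltr0n //.
  move: leV big; rewrite !natrD; lra.
by rewrite -!natrM ltr_nat; nia.
Qed.

End LubellOn.

(** * Embedding a poset of height at most 2 *)

Lemma height2_no_chain3 (d : Order.disp_t) (P : finPOrderType d) (x y z : P) :
  (height P <= 2)%N -> (x < y)%O -> ~~ (y < z)%O.
Proof.
move=> hP xy; apply/negP => yz; have xz := lt_trans xy yz.
suff : (3 <= height P)%N by rewrite leqNgt ltnS hP.
have -> : 3%N = #|[set x; y; z]|.
  by rewrite -setUA cardsU1 cards2 !inE negb_or !lt_eqF.
apply: leq_bigmax_cond; apply/forall_inP => a aC; apply/forall_inP => b bC.
move: aC bC; rewrite !inE.
by move=> /orP[/orP[]|] /eqP-> /orP[/orP[]|] /eqP->;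
  rewrite ?lexx ?(ltW xy) ?(ltW yz) ?(ltW xz) ?orbT.
Qed.

Lemma height2_contains_copy (n : nat) (d : Order.disp_t) (P : finPOrderType d)
    (F : {set {set 'I_n}}) (W V E : {set 'I_n}) :
  (height P <= 2)%N -> W \subset V -> #|E| = #|P| ->
  E \subset ~: V :\: uncovered F W ->
  (forall S : {set 'I_n}, S \subset E ->
     exists Y : {set 'I_n}, [/\ Y \in F, V \subset Y & Y :&: E = S]) ->
  contains_copy P F.
Proof.
move=> hP WV cE EG sh.
pose e (x : P) : 'I_n := enum_val (cast_ord (esym cE) (enum_rank x)).
have e_inj : injective e.
  by move=> x y /enum_val_inj/cast_ord_inj/enum_rank_inj.
have eE x : e x \in E by apply: enum_valP.
pose down (x : P) : {set 'I_n} := e @: [set z | (z <= x)%O].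
have mem_down x z : (e z \in down x) = (z <= x)%O.
  by rewrite mem_imset // inE.
have [f fP] : exists f : P -> {set 'I_n}, forall x,
    [/\ f x \in F, f x :&: E = down x &
      if [exists z, (z < x)%O] then V \subset f x else f x \subset e x |: V].
  apply: (@fin_all_exists _ (fun=> {set 'I_n}) (fun x X => [/\ X \in F, X :&: E = down x &
    if [exists z, (z < x)%O] then V \subset X else X \subset e x |: V])) => x.
  have dE : down x \subset E by apply/subsetP => _ /imsetP[z _ ->].
  case: (boolP [exists z, (z < x)%O]) => [_|].
    by have [Y [YF VY YE]] := sh _ dE; exists Y.
  rewrite negb_exists => /forallP min_x.
  have := subsetP EG _ (eE x); rewrite !inE => /andP[].
  have exW : e x \notin V.
    by have := subsetP EG _ (eE x); rewrite !inE => /andP[].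
  rewrite (contra (subsetP WV _) exW) /= negbK => /exists_inP[X XF /andP[exX XW]] _.
  have XV : X \subset e x |: V by rewrite (subset_trans XW) // setUS.
  (* Since [E] is disjoint from [V], the set [X] meets [E] only in [e x], which is the only point of
     [down x] by minimality. *)
  exists X; split=> //; apply/setP => v; rewrite inE.
  apply/andP/imsetP => [[vX vE]|[z]].
    have := subsetP XV _ vX; rewrite !inE => /orP[/eqP->|vV].
      by exists x; rewrite ?inE.
    by have := subsetP EG _ vE; rewrite !inE vV andbF.
  rewrite inE le_eqVlt (negPf (min_x z)) orbF => /eqP-> ->.
  by rewrite exX eE.
have fle x y : (x <= y)%O = (f x \subset f y).
  have [_ fxE fxV] := fP x; have [_ fyE fyV] := fP y.
  (* Inclusion puts [e x] into the trace [down y]. Conversely, if [x < y] then the height makes [x]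
     minimal, and [f x] lies in [e x |: V], which lies in [f y]. *)
  apply/idP/idP => [|sxy]; last first.
    have : e x \in f x :&: E by rewrite fxE mem_down.
    rewrite inE => /andP[/(subsetP sxy) exy _].
    by rewrite -mem_down -fyE inE exy eE.
  rewrite le_eqVlt => /orP[/eqP-> //|xy].
  have nminy : [exists z, (z < y)%O] by apply/existsP; exists x.
  have minx : [exists z, (z < x)%O] = false.
    apply/negbTE; rewrite negb_exists; apply/forallP => z.
    by apply/negP => /(height2_no_chain3 y hP); rewrite xy.
  rewrite nminy in fyV; rewrite minx in fxV.
  apply: subset_trans fxV _; rewrite subUset fyV andbT sub1set.
  have : e x \in f y :&: E by rewrite fyE mem_down ltW.
  by rewrite inE => /andP[].
exists (f @: [set: P]); first by apply/subsetP => _ /imsetP[x _ ->]; case: (fP x).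
exists f; split=> // x y fxy.
by apply: le_anti; rewrite !fle fxy subxx.
Qed.

From mathcomp Require Import all_classical all_reals all_analysis.

Theorem theorem3p8 (R : realType) (r : nat) (d : Order.disp_t)
    (P : finPOrderType d) (r_gt0 : (0 < r)%N) (cardP : #|P| = r)
    (heightP : (height P <= 2)%N) :
  (strong_lubell R P <=
     (4 * r%:R + Num.sqrt ((32 * ln 2) * r%:R) + 6)%:E)%E.
Proof.
apply: ge_ereal_sup => _ [n [F [_ freeF ->]]]; rewrite lee_fin.
(* Each [P]-free family obeys the sharper bound [4 * r + 4]; the claim follows as the square root is
   nonnegative. *)
apply: (@le_trans _ _ (4 * r + 4)%:R).
  rewrite leNgt; apply/negP => big.
  have lubE : lubell R F = lubell_on R [set: 'I_n] F.
    rewrite /lubell /lubell_on cardsT card_ord.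
    by apply: eq_bigl => A; rewrite finset.subsetT andbT.
  rewrite lubE in big; have [W [V [E [WV cE EG sh]]]] := covered_shatters r_gt0 big.
  by apply: freeF; apply: (height2_contains_copy heightP WV _ EG sh); rewrite cE.
have := sqrtr_ge0 (32 * ln 2 * r%:R : R); rewrite natrD natrM; lra.
Qed.
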